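(* Let $M$ be a closed term. For each $k\in\mathbb{N}$ there exists a tight derivation of $\vdash^{w}M:\mathtt{a}$ such that $\|\mathtt{a}\|=\mathcal{P}_k(M)$ and $w\ge\mathcal{E}_k(M)$.
   Context: Terms: values $V ::= x \mid \lambda x.M$; terms $M ::= V \mid VV \mid M\oplus M \mid \mathtt{let}\ x = M\ \mathtt{in}\ M$; $M\{V/x\}$ is capture-avoiding substitution. A multidistribution on terms is a finite multiset $\langle p_iM_i\rangle_{i\in I}$ with $p_i\in(0,1]$, $\sum_ip_i\le1$; $\sqcup$ is multiset union and $q\cdot\langle p_iM_i\rangle=\langle (qp_i)M_i\rangle$. One-step reduction: $(\lambda x.M)V\to\langle 1\,M\{V/x\}\rangle$; $\mathtt{let}\ x=V\ \mathtt{in}\ M\to\langle 1\,M\{V/x\}\rangle$; $M\oplus N\to\langle\tfrac12 M,\tfrac12 N\rangle$; if $N\to\langle p_iN_i\rangle_{i\in I}$ then $\mathtt{let}\ x=N\ \mathtt{in}\ M\to\langle p_i(\mathtt{let}\ x=N_i\ \mathtt{in}\ M)\rangle_{i\in I}$. Lifting to multidistributions of closed terms: $\langle p_iM_i\rangle_{i\in I}\Rightarrow\bigsqcup_i p_i\cdot\mathbf{m}_i$ where $\mathbf{m}_i=\langle 1M_i\rangle$ if $M_i$ is a value and $M_i\to\mathbf{m}_i$ otherwise. For closed $M$ let $\langle 1M\rangle=\mathbf{m}_0\Rightarrow\mathbf{m}_1\Rightarrow\cdots$; $\mathcal{P}_k(M)$ is the sum of the probabilities of the values occurring in $\mathbf{m}_k$,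 and $\mathcal{E}_k(M)=\sum_{j=0}^{k-1}(1-\mathcal{P}_j(M))$. Types: arrow types $\mathtt{A} ::= \mathcal{M}\to \mathtt{a}$; intersection types $\mathcal{M} ::= [q_1\cdot \mathtt{A}_1,\dots,q_n\cdot\mathtt{A}_n]$ ($n\ge0$, scale factors $q_i\in(0,1]\cap\mathbb{Q}$); type distributions $\mathtt{a} ::= \langle p_1\mathcal{M}_1,\dots,p_n\mathcal{M}_n\rangle$ ($n\ge0$, $p_i\in(0,1]$, $\sum p_i\le1$), with norm $\|\mathtt{a}\|=\sum_i p_i$; $\mathbf{0}$ is the empty type distribution. Scaling: $u\cdot[q_i\cdot\mathtt{A}_i]_i=[(uq_i)\cdot \mathtt{A}_i]_i$, $u\cdot\langle p_i\mathcal{M}_i\rangle_i=\langle (up_i)\mathcal{M}_i\rangle_i$; $\uplus,\sqcup$ multiset unions. Typing contexts map variables to intersection types (finitely many nonempty), pointwise $\uplus$ and scaling. Rules for $\Gamma\vdash^{w}M:\tau$ ($w\in\mathbb{Q}$): (Var) $x:\mathcal{M}\vdash^0 x:\mathcal{M}$. (Zero) $\vdash^0 M:\mathbf{0}$. (@) from $\Gamma\vdash^{w}V:[1\cdot(\mathcal{M}\to\mathtt{b})]$, $\Delta\vdash^{v}W:\mathcal{M}$ infer $\Gamma\uplus\Delta\vdash^{w+v}VW:\mathtt{b}$. ($\oplus$) from $\Gamma\vdash^{w}M:\mathtt{a}$, $\Delta\vdash^{v}N:\mathtt{b}$ infer $\tfrac12\cdot\Gamma\uplus\tfrac12\cdot\Delta\vdash^{\frac12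 w+\frac12 v+1}M\oplus N:\tfrac12\mathtt{a}\sqcup\tfrac12\mathtt{b}$. ($\lambda$) from $\Gamma,x:\mathcal{M}\vdash^{w}M:\mathtt{b}$ infer $\Gamma\vdash^{w+1}\lambda x.M:\mathcal{M}\to\mathtt{b}$. (let) from $\Gamma\vdash^{v}N:\langle p_k\mathcal{M}_k\rangle_{k\in K}$ and $\Delta_k,x:\mathcal{M}_k\vdash^{w_k}M:\mathtt{b}_k$ ($k\in K$) infer $\Gamma\uplus_{k}p_k\cdot\Delta_k\vdash^{\sum_k p_kw_k+v+1}\mathtt{let}\ x=N\ \mathtt{in}\ M:\bigsqcup_k p_k\mathtt{b}_k$. (Val) from $\Gamma\vdash^{w}V:\mathcal{M}$ infer $\Gamma\vdash^{w}V:\langle 1\mathcal{M}\rangle$. (!) for finite possibly empty $I$, from $\Gamma_i\vdash^{w_i}V:\mathtt{A}_i$ and scale factors $q_i$ infer $\uplus_i q_i\cdot\Gamma_i\vdash^{\sum_i q_iw_i}V:[q_i\cdot\mathtt{A}_i]_{i\in I}$. A type distribution is tight if it has the form $\langle q_k[\,]\rangle_{k\in K}$ ($K$ possibly empty); a derivation of $\vdash^{w}M:\mathtt{a}$ (empty context) is tight if $\mathtt{a}$ is tight. *)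

(* Defs.v *)
From mathcomp Require Import all_boot all_order all_algebra.
Set Implicit Arguments.
Unset Strict Implicit.
Unset Printing Implicit Defensive.
Import Order.TTheory GRing.Theory Num.Theory.
Local Open Scope ring_scope.

(* A finite multiset of weighted elements <q_1 x_1, ..., q_n x_n> is
   represented by the list of the pairs (q_i, x_i).  All probabilities, scale
   factors and weights are rational. *)
Definition wlist (T : Type) := seq (rat * T).

Definition scale (T : Type) (u : rat) (s : wlist T) : wlist T :=
  [seq (u * x.1, x.2) | x <- s].

Definition unit_factor (q : rat) : bool := (0 < q) && (q <= 1).

(* Terms, with de Bruijn indices: vLam and the second argument of tLet bind
   index 0. *)
Inductive value : Type :=
  | vVar of nat
  | vLam of term
with term : Type :=
  | tVal of value
  | tApp of value & value
  | tPlus of term & term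
  | tLet of term & term.

Definition up_ren (r : nat -> nat) (i : nat) : nat :=
  if i is j.+1 then (r j).+1 else 0%N.

Fixpoint ren_val (r : nat -> nat) (V : value) : value :=
  match V with
  | vVar i => vVar (r i)
  | vLam M => vLam (ren_term (up_ren r) M)
  end
with ren_term (r : nat -> nat) (M : term) : term :=
  match M with
  | tVal V => tVal (ren_val r V)
  | tApp V W => tApp (ren_val r V) (ren_val r W)
  | tPlus M N => tPlus (ren_term r M) (ren_term r N)
  | tLet N M => tLet (ren_term r N) (ren_term (up_ren r) M)
  end.

Definition up_sub (s : nat -> value) (i : nat) : value :=
  if i is j.+1 then ren_val succn (s j) else vVar 0.

Fixpoint sub_val (s : nat -> value) (V : value) : value :=
  match V with
  | vVar i => s i
  | vLam M => vLam (sub_term (up_sub s) M)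
  end
with sub_term (s : nat -> value) (M : term) : term :=
  match M with
  | tVal V => tVal (sub_val s V)
  | tApp V W => tApp (sub_val s V) (sub_val s W)
  | tPlus M N => tPlus (sub_term s M) (sub_term s N)
  | tLet N M => tLet (sub_term s N) (sub_term (up_sub s) M)
  end.

(* M{V/x}, where x is the variable of index 0 in M; the other free variables
   of M are lowered by one. *)
Definition subst0 (M : term) (V : value) : term :=
  sub_term (fun i => if i is j.+1 then vVar j else V) M.

(* All the free indices are below n. *)
Fixpoint scoped_val (n : nat) (V : value) : bool :=
  match V with
  | vVar i => (i < n)%N
  | vLam M => scoped_term n.+1 M
  end
with scoped_term (n : nat) (M : term) : bool :=
  match M with
  | tVal V => scoped_val n V
  | tApp V W => scoped_val n V && scoped_val n W
  | tPlus M N => scoped_term n M && scoped_term n N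
  | tLet N M => scoped_term n N && scoped_term n.+1 M
  end.

Definition closed_term (M : term) : bool := scoped_term 0 M.

Definition is_value (M : term) : bool := if M is tVal _ then true else false.

(* Multidistributions.  The constraints on the probabilities (positive, of
   sum at most 1) need not be imposed: they hold for <1 M> and are preserved
   by reduction. *)
Definition mdist := wlist term.

Inductive red : term -> mdist -> Prop :=
  | red_beta M V : red (tApp (vLam M) V) [:: (1, subst0 M V)]
  | red_letv V M : red (tLet (tVal V) M) [:: (1, subst0 M V)]
  | red_plus M N : red (tPlus M N) [:: (2^-1, M); (2^-1, N)]
  | red_let N M m : red N m ->
      red (tLet N M) [seq (x.1, tLet x.2 M) | x <- m].

Inductive red_or_val : term -> mdist -> Prop :=
  | rv_val V : red_or_val (tVal V) [:: (1, tVal V)]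
  | rv_red M m : ~~ is_value M -> red M m -> red_or_val M m.

Inductive mred : mdist -> mdist -> Prop :=
  | mred_nil : mred [::] [::]
  | mred_cons p M mi m m' : red_or_val M mi -> mred m m' ->
      mred ((p, M) :: m) (scale p mi ++ m').

(* <1 M> = m 0 => m 1 => m 2 => ... *)
Definition reduction_seq (M : term) (m : nat -> mdist) : Prop :=
  m 0%N = [:: (1, M)] /\ forall k, mred (m k) (m k.+1).

(* The reduction sequence of a closed term exists and is unique. *)
Scheme value_mind := Induction for value Sort Prop
  with term_mind := Induction for term Sort Prop.
Combined Scheme value_term_ind from value_mind, term_mind.

Lemma scoped_ren :
  (forall V n k r, (forall i, (i < n)%N -> (r i < k)%N) ->
     scoped_val n V -> scoped_val k (ren_val r V)) /\
  (forall M n k r, (forall i, (i < n)%N -> (r i < k)%N) ->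
     scoped_term n M -> scoped_term k (ren_term r M)).
Proof.
have up n k r : (forall i, (i < n)%N -> (r i < k)%N) ->
  forall i, (i < n.+1)%N -> (up_ren r i < k.+1)%N.
  by move=> hr [|i] //= /hr.
apply: value_term_ind => /=.
- by move=> i n k r hr; apply: hr.
- by move=> M IH n k r hr; apply: IH; apply: up.
- by move=> V IH n k r hr; apply: IH.
- by move=> V IHV W IHW n k r hr /andP[hV hW]; rewrite (IHV n) ?(IHW n).
- by move=> M IHM N IHN n k r hr /andP[hM hN]; rewrite (IHM n) ?(IHN n).
- move=> N IHN M IHM n k r hr /andP[hN hM].
  by rewrite (IHN n) ?(IHM n.+1) //; apply: up.
Qed.

Lemma scoped_sub :
  (forall V n k s, (forall i, (i < n)%N -> scoped_val k (s i)) ->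
     scoped_val n V -> scoped_val k (sub_val s V)) /\
  (forall M n k s, (forall i, (i < n)%N -> scoped_val k (s i)) ->
     scoped_term n M -> scoped_term k (sub_term s M)).
Proof.
have up n k s : (forall i, (i < n)%N -> scoped_val k (s i)) ->
  forall i, (i < n.+1)%N -> scoped_val k.+1 (up_sub s i).
  by move=> hs [|i] //= /hs; apply: scoped_ren.1.
apply: value_term_ind => /=.
- by move=> i n k s hs; apply: hs.
- by move=> M IH n k s hs; apply: IH; apply: up.
- by move=> V IH n k s hs; apply: IH.
- by move=> V IHV W IHW n k s hs /andP[hV hW]; rewrite (IHV n) ?(IHW n).
- by move=> M IHM N IHN n k s hs /andP[hM hN]; rewrite (IHM n) ?(IHN n).
- move=> N IHN M IHM n k s hs /andP[hN hM].
  by rewrite (IHN n) ?(IHM n.+1) //; apply: up.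
Qed.

Definition closed_mdist (m : mdist) : bool := all (fun x => closed_term x.2) m.

Lemma closed_subst0 M V :
  scoped_term 1 M -> scoped_val 0 V -> closed_term (subst0 M V).
Proof. by move=> hM hV; apply: scoped_sub.2 hM => -[]. Qed.

Lemma closed_progress M : closed_term M ->
  {m | red_or_val M m & closed_mdist m}.
Proof.
rewrite /closed_mdist /closed_term.
elim: M => [V|V W|M _ N _|N IH M _] /= hM.
- by exists [:: (1, tVal V)]; [constructor | rewrite /= hM].
- case/andP: hM; case: V => [//|M] hM hW.
  exists [:: (1, subst0 M W)]; first by do 2 constructor.
  by rewrite /= [scoped_term _ _]closed_subst0.
- exists [:: (2^-1, M); (2^-1, N)]; first by do 2 constructor.
  by rewrite /= andbT.
- case/andP: hM => hN hM; case EN: (is_value N).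
  + case: N hN EN {IH} => // V hV _.
    exists [:: (1, subst0 M V)]; first by do 2 constructor.
    by rewrite /= [scoped_term _ _]closed_subst0.
  + have [m mP cm] := IH hN; exists [seq (x.1, tLet x.2 M) | x <- m].
      constructor=> //; constructor.
      by case: mP EN => [//|N' m' _ redN].
    by rewrite all_map; apply: sub_all cm => x /= ->.
Qed.

Lemma closed_mred m : closed_mdist m -> {m' | mred m m' & closed_mdist m'}.
Proof.
elim: m => [|[p M] m IH] /=; first by exists [::]; [constructor|].
case/andP=> hM /IH[m' r' c']; have [mi ri ci] := closed_progress hM.
exists (scale p mi ++ m'); first by constructor.
by rewrite /closed_mdist all_cat all_map; apply/andP; split.
Qed.

Lemma reduction_seq_exists M : closed_term M -> exists m, reduction_seq M m.
Proof.
move=> cM; have c0 : closed_mdist [:: (1, M)] by rewrite /closed_mdist /= cM.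
pose next (x : {m | closed_mdist m}) : {m | closed_mdist m} :=
  let: exist2 m' _ c' := closed_mred (svalP x) in exist _ m' c'.
have nextP x : mred (sval x) (sval (next x)).
  by rewrite /next; case: (closed_mred (svalP x)).
exists (fun k => sval (iter k next (exist (fun m => closed_mdist m) _ c0))).
by split=> // k; apply: nextP.
Qed.

Lemma red_fun M m m' : red M m -> red M m' -> m = m'.
Proof.
move=> r; elim: r m' => {M m} [M V|V M|M N|N M m r IH] m' r'.
- by inversion r'.
- inversion r' => //; subst.
  by match goal with h : red (tVal _) _ |- _ => inversion h end.
- by inversion r'.
- by inversion r'; subst; [inversion r | rewrite (IH _ H2)].
Qed.

Lemma mred_fun m m1 m2 : mred m m1 -> mred m m2 -> m1 = m2.
Proof.
move=> r; elim: r m2 => {m m1} [|p M mi m m' hi _ IH] m2 r2; inversion r2 => //.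
subst; rewrite (IH _ H4); congr (scale _ _ ++ _).
case: hi H3 => [V|N n nv rN] h; inversion h => //; subst => //.
exact: red_fun rN _.
Qed.

Lemma reduction_seq_unique M m m' :
  reduction_seq M m -> reduction_seq M m' -> m =1 m'.
Proof.
move=> [e r] [e' r']; elim=> [|k IH]; first by rewrite e.
by apply: mred_fun (r k) _; rewrite IH.
Qed.

(* P_k(M) and E_k(M), computed from the reduction sequence m of M. *)
Definition val_prob (m : nat -> mdist) (k : nat) : rat :=
  \sum_(x <- m k | is_value x.2) x.1.
Definition expected_steps (m : nat -> mdist) (k : nat) : rat :=
  \sum_(j < k) (1 - val_prob m j).

(* Types.  In "Arr M b", M is an intersection type (ity) and b a type
   distribution (dty). *)
Inductive aty : Type := Arr of wlist aty & wlist (wlist aty).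
Definition ity := wlist aty.
Definition dty := wlist ity.

Definition dnorm (a : dty) : rat := \sum_(x <- a) x.1.

Fixpoint wf_aty (A : aty) : bool :=
  let: Arr M b := A in
  let wf M := all (fun x => unit_factor x.1 && wf_aty x.2) M in
  [&& wf M, all (fun x => unit_factor x.1 && wf x.2) b
    & \sum_(x <- b) x.1 <= 1].
Definition wf_ity (M : ity) : bool :=
  all (fun x => unit_factor x.1 && wf_aty x.2) M.

(* Equality of finite multisets of weighted elements, given an equality R on
   the elements. *)
Inductive meq (T : Type) (R : T -> T -> Prop) : wlist T -> wlist T -> Prop :=
  | meq_nil : meq R [::] [::]
  | meq_cons q x y s t : R x y -> meq R s t -> meq R ((q, x) :: s) ((q, y) :: t)
  | meq_swap a b s : meq R [:: a, b & s] [:: b, a & s]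
  | meq_trans s t u : meq R s t -> meq R t u -> meq R s u.

(* Types are multisets at every nesting level. *)
Inductive aeq : aty -> aty -> Prop :=
  | aeq_arr M M' b b' :
      meq aeq M M' -> meq (meq aeq) b b' -> aeq (Arr M b) (Arr M' b').
Notation ieq := (meq aeq).
Notation deq := (meq (meq aeq)).

(* Typing contexts, indexed by de Bruijn indices.  Derivable judgments only
   have finitely many nonempty entries. *)
Definition ctx := nat -> ity.
Definition ctx0 : ctx := fun=> [::].
Definition ctx1 (x : nat) (M : ity) : ctx := fun i =>
  if i == x then M else [::].
Definition ctx_cons (M : ity) (G : ctx) : ctx := fun i =>
  if i is j.+1 then G j else M.
Definition ctx_add (G D : ctx) : ctx := fun i => G i ++ D i.
Definition ctx_scale (u : rat) (G : ctx) : ctx := fun i => scale u (G i).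
Definition ctx_eq (G D : ctx) : Prop := forall i, ieq (G i) (D i).

(* u_0 . s_0 + ... + u_(n-1) . s_(n-1), as a multiset union *)
Definition wsum (T : Type) (n : nat) (u : 'I_n -> rat) (s : 'I_n -> wlist T) :
    wlist T :=
  flatten [seq scale (u k) (s k) | k <- enum 'I_n].
Definition ctx_wsum (n : nat) (u : 'I_n -> rat) (G : 'I_n -> ctx) : ctx :=
  fun i => wsum u (fun k => G k i).
Definition wfam (T : Type) (n : nat) (u : 'I_n -> rat) (x : 'I_n -> T) :
    wlist T :=
  [seq (u k, x k) | k <- enum 'I_n].

(* The judgments G |-^w V : A, G |-^w V : M and G |-^w M : a, for arrow types,
   intersection types and type distributions respectively.  The rules *_eq
   express that types and contexts are taken up to equality of multisets.
   Well-formedness of the types and contexts is imposed where they are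
   introduced (in ihas_var and ihas_bang); typing_wf shows that it then
   holds of all derivable judgments. *)
Inductive ahas : ctx -> rat -> value -> aty -> Prop :=
  | ahas_lam G w N M b :
      dhas (ctx_cons M G) w N b -> ahas G (w + 1) (vLam N) (Arr M b)
  | ahas_eq G G' w V A A' :
      ctx_eq G G' -> aeq A A' -> ahas G w V A -> ahas G' w V A'
with ihas : ctx -> rat -> value -> ity -> Prop :=
  | ihas_var x M : wf_ity M -> ihas (ctx1 x M) 0 (vVar x) M
  | ihas_bang n (q : 'I_n -> rat) (G : 'I_n -> ctx) (w : 'I_n -> rat)
      V (A : 'I_n -> aty) :
      (forall i, unit_factor (q i)) -> (forall i, ahas (G i) (w i) V (A i)) ->
      ihas (ctx_wsum q G) (\sum_i q i * w i) V (wfam q A)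
  | ihas_eq G G' w V M M' :
      ctx_eq G G' -> ieq M M' -> ihas G w V M -> ihas G' w V M'
with dhas : ctx -> rat -> term -> dty -> Prop :=
  | dhas_zero M : dhas ctx0 0 M [::]
  | dhas_val G w V M : ihas G w V M -> dhas G w (tVal V) [:: (1, M)]
  | dhas_app G D w v V W M b :
      ihas G w V [:: (1, Arr M b)] -> ihas D v W M ->
      dhas (ctx_add G D) (w + v) (tApp V W) b
  | dhas_plus G D w v M N a b :
      dhas G w M a -> dhas D v N b ->
      dhas (ctx_add (ctx_scale 2^-1 G) (ctx_scale 2^-1 D))
        (2^-1 * w + 2^-1 * v + 1) (tPlus M N) (scale 2^-1 a ++ scale 2^-1 b)
  | dhas_let n (p : 'I_n -> rat) (T : 'I_n -> ity) G v N
      (D : 'I_n -> ctx) (w : 'I_n -> rat) M (b : 'I_n -> dty) :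
      dhas G v N (wfam p T) ->
      (forall k, dhas (ctx_cons (T k) (D k)) (w k) M (b k)) ->
      dhas (ctx_add G (ctx_wsum p D)) (\sum_k p k * w k + v + 1)
        (tLet N M) (wsum p b)
  | dhas_eq G G' w M a a' :
      ctx_eq G G' -> deq a a' -> dhas G w M a -> dhas G' w M a'.

Definition tight (a : dty) : bool := all (fun x => nilp x.2) a.

(* transparent for the guard condition of aeq_wf *)
Lemma meq_all T (R : T -> T -> Prop) (f : T -> bool) s t :
  (forall x y, R x y -> f x = f y) -> meq R s t ->
  all (fun x => unit_factor x.1 && f x.2) s =
  all (fun x => unit_factor x.1 && f x.2) t.
Proof.
move=> H; elim=> {s t}
  [|q x y s t /H /= -> _ ->|[a x] [b y] s|s t u _ -> _ ->] //=.
by rewrite andbCA.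
Defined.

Lemma meq_dnorm T (R : T -> T -> Prop) s t :
  meq R s t -> \sum_(x <- s) x.1 = \sum_(x <- t) x.1 :> rat.
Proof.
move=> h; elim: h => [|q x y s1 t1 _ _ e|a b s1|s1 t1 u _ e1 _ e2].
- by [].
- by rewrite !big_cons e.
- by rewrite !big_cons addrCA.
- by rewrite e1.
Qed.

Fixpoint aeq_wf A A' (h : aeq A A') {struct h} : wf_aty A = wf_aty A'.
Proof.
case: h => M M' b b' hM hb /=.
congr [&& _, _ & _].
- exact: meq_all aeq_wf hM.
- exact: meq_all (fun x y => meq_all aeq_wf) hb.
- by rewrite (meq_dnorm hb).
Qed.

Definition wf_dty (a : dty) : bool :=
  all (fun x => unit_factor x.1 && wf_ity x.2) a && (dnorm a <= 1).

Scheme ahas_mind := Minimality for ahas Sort Prop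
  with ihas_mind := Minimality for ihas Sort Prop
  with dhas_mind := Minimality for dhas Sort Prop.
Combined Scheme has_ind from ahas_mind, ihas_mind, dhas_mind.

Definition wf_ctx (G : ctx) := forall i, wf_ity (G i).

Lemma typing_wf :
  [/\ forall G w V A, ahas G w V A -> wf_ctx G /\ wf_aty A,
     forall G w V M, ihas G w V M -> wf_ctx G /\ wf_ity M
   & forall G w M a, dhas G w M a -> wf_ctx G /\ wf_dty a].
Proof.
pose okT (T : Type) (f : T -> bool) (s : wlist T) :=
  all (fun x => unit_factor x.1 && f x.2) s.
have ufM u q : unit_factor u -> unit_factor q -> unit_factor (u * q).
  move=> /andP[u0 u1] /andP[q0 q1].
  by rewrite /unit_factor mulr_gt0 // mulr_ile1 // ltW.
have scW T (f : T -> bool) u s :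
  unit_factor u -> okT T f s -> okT T f (scale u s).
  move=> hu; rewrite /okT all_map; apply: sub_all => x /= /andP[h ->].
  by rewrite ufM.
have wsW T (f : T -> bool) n (u : 'I_n -> rat) s :
  (forall k, unit_factor (u k)) -> (forall k, okT T f (s k)) ->
  okT T f (wsum u s).
  move=> hu hs; rewrite /wsum; elim: (enum _) => //= k l IH.
  by rewrite /okT all_cat; apply/andP; split=> //; apply: scW.
have nsc T u (s : wlist T) : \sum_(x <- scale u s) x.1 = u * \sum_(x <- s) x.1.
  by rewrite big_map mulr_sumr.
have uf2 : unit_factor 2^-1 by [].
have ceq G G' : ctx_eq G G' -> wf_ctx G -> wf_ctx G'.
  by move=> e h i; rewrite /wf_ity -(meq_all aeq_wf (e i)); apply: h.
suff [a [b c]] : (forall G w V A, ahas G w V A -> wf_ctx G /\ wf_aty A) /\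
    (forall G w V M, ihas G w V M -> wf_ctx G /\ wf_ity M) /\
    (forall G w M a, dhas G w M a -> wf_ctx G /\ wf_dty a) by [].
apply: has_ind.
- move=> G w N M b _ [hG hb]; split=> [i|/=]; first exact: (hG i.+1).
  by have := hG 0%N; rewrite /= /wf_ity => ->.
- move=> G G' w V A A' e ea _ [hG hA]; split; first exact: ceq hG.
  by rewrite -(aeq_wf ea).
- move=> x M hM; split=> // i; rewrite /ctx1; by case: ifP.
- move=> n q G w V A hq _ IH; split.
    by move=> i; apply: wsW => // k; have [h _] := IH k; apply: h.
  rewrite /wf_ity /wfam all_map; apply/allP => k _ /=.
  by rewrite hq; case: (IH k).
- move=> G G' w V M M' e ea _ [hG hA]; split; first exact: ceq hG.
  by rewrite /wf_ity -(meq_all aeq_wf ea).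
- by move=> M; split=> //; rewrite /wf_dty /dnorm big_nil.
- move=> G w V M _ [hG hM]; split=> //.
  by rewrite /wf_dty /dnorm big_seq1 /= hM.
- move=> G D w v V W M b _ [hG hA] _ [hD _]; split.
    move=> i; rewrite /wf_ity all_cat.
    by apply/andP; split; [apply: hG|apply: hD].
  have /andP[/andP[_ /and3P[_ h1 h2]] _] := hA; by apply/andP.
- move=> G D w v M N a b _ [hG /andP[ha na]] _ [hD /andP[hb nb]]; split.
    by move=> i; rewrite /wf_ity all_cat; apply/andP; split; apply: scW.
  rewrite /wf_dty all_cat -andbA; apply/and3P; split; try exact: scW.
  rewrite /dnorm big_cat /= !nsc -mulrDr mulrC ler_pdivrMr // mul1r.
  exact: lerD na nb.
- move=> n p T G v N D w M b _ [hG /andP[hp np]] _ IH.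
  have hpk k : unit_factor (p k).
    move: hp; rewrite all_map => /allP/(_ k); rewrite mem_enum => /(_ isT) /=.
    by case/andP.
  split.
    move=> i; rewrite /wf_ity all_cat; apply/andP; split; first exact: hG.
    by apply: wsW => // k; have [h _] := IH k; apply: (h i.+1).
  apply/andP; split; first by apply: wsW => // k; case: (IH k) => _ /andP[].
  apply: le_trans np; rewrite /dnorm /wsum /wfam big_map.
  elim: (enum _) => [|k l le]; first by rewrite !big_nil.
  rewrite /= big_cat big_cons /= nsc; apply: lerD le.
  have [_ /andP[_ h]] := IH k; have /andP[p0 _] := hpk k.
  by rewrite ger_pMr.
- move=> G G' w M a a' e ea _ [hG /andP[ha na]]; split; first exact: ceq hG.
  apply/andP; split; last by rewrite /dnorm -(meq_dnorm ea).
  by rewrite -(meq_all (fun x y => meq_all aeq_wf) ea).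
Qed.

(* Main.v *)
Require Import Defs.
From mathcomp Require Import all_boot all_order all_algebra.
From mathcomp Require Import ring lra.
Import Order.TTheory GRing.Theory Num.Theory.
Local Open Scope ring_scope.

(** The proof is by weighted subject expansion along the lifted reduction: if
    [M] reduces to [<p_i M_i>] and the [M_i] have typings of type [a_i] and
    weight [w_i], then [M] has type [p_1 a_1 + ... + p_n a_n] with a weight of
    at least [1 + p_1 w_1 + ... + p_n w_n].  The weight can be larger because
    of rule (Zero): in [let x = N in M], a typing by (Zero) of a reduct is first
    replaced by a heavier one by (let).  Starting from [m k], where values get
    type [<1 []>] and the other terms the empty type, every expansion step adds
    at least the mass of the non-values, which is the corresponding summand of
    [expected_steps]. *)

(** * Equality of multisets and contexts *)

Section MultisetEquality.
Context {T : Type} {R : T -> T -> Prop}.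

Section Reflexivity.
Hypothesis R_refl : forall x, R x x.

(* Transparent for the guard condition of [aeq_refl]. *)
Fixpoint meq_refl (s : wlist T) : meq R s s :=
  match s with
  | [::] => meq_nil R
  | (q, x) :: s' => meq_cons q (R_refl x) (meq_refl s')
  end.

Lemma meq_cat (s s' t t' : wlist T) :
  meq R s s' -> meq R t t' -> meq R (s ++ t) (s' ++ t').
Proof.
move=> h; elim: h t t' => {s s'} //=.
- by move=> q x y s s' xy _ IH t t' /IH; apply: meq_cons.
(* [meq_swap] needs the same tail on both sides, so the two heads are exchanged first and [t] is
   replaced by [t'] afterwards. *)
- move=> [p x] [q y] s t t' tt'; apply: meq_trans (meq_swap _ _ _ _) _.
  do 2 apply: meq_cons => //.
  by elim: s => [|[r z] s IH] //=; apply: meq_cons.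
- move=> s1 s2 s3 _ IH1 _ IH2 t t' tt'.
  exact: meq_trans (IH1 _ _ tt') (IH2 _ _ (meq_refl t')).
Qed.

End Reflexivity.

Lemma meq_scale u (s t : wlist T) : meq R s t -> meq R (scale u s) (scale u t).
Proof.
elim=> {s t} [|q x y s t xy _ IH|a b s|s1 s2 s3 _ IH1 _ IH2] /=.
- exact: meq_nil.
- exact: meq_cons.
- exact: meq_swap.
- exact: meq_trans IH1 IH2.
Qed.

Lemma meq_size (s t : wlist T) : meq R s t -> size s = size t.
Proof. by elim=> {s t} //= [q x y s t _ _ ->|s1 s2 s3 _ -> _ ->]. Qed.

Lemma meq_nil_l (t : wlist T) : meq R [::] t -> t = [::].
Proof. by move/meq_size; case: t. Qed.

Lemma meq_nil_r (s : wlist T) : meq R s [::] -> s = [::].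
Proof. by move/meq_size; case: s. Qed.

End MultisetEquality.

Fixpoint aeq_refl (A : aty) : aeq A A :=
  match A with
  | Arr M b => aeq_arr (meq_refl aeq_refl M) (meq_refl (meq_refl aeq_refl) b)
  end.

Definition ieq_refl := meq_refl aeq_refl.
Definition deq_refl := meq_refl ieq_refl.

Lemma aeq_trans A B C : aeq A B -> aeq B C -> aeq A C.
Proof.
case=> M M' b b' hM hb h; inversion h; subst.
by apply: aeq_arr; [apply: meq_trans hM _ | apply: meq_trans hb _].
Qed.

Lemma ctx_eqE (G D : ctx) : G =1 D -> ctx_eq G D.
Proof. by move=> e i; rewrite e; apply: ieq_refl. Qed.

Lemma ctx_eq_refl (G : ctx) : ctx_eq G G.
Proof. exact: ctx_eqE. Qed.

Lemma ctx_eq_trans (G D E : ctx) : ctx_eq G D -> ctx_eq D E -> ctx_eq G E.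
Proof. by move=> h1 h2 i; apply: meq_trans (h1 i) (h2 i). Qed.

Lemma ctx_eq0E (G : ctx) : ctx_eq G ctx0 -> G =1 ctx0.
Proof. by move=> h i; apply: meq_nil_r (h i). Qed.

Lemma ctx_add_eq0 (G D : ctx) :
  ctx_eq (ctx_add G D) ctx0 -> ctx_eq G ctx0 /\ ctx_eq D ctx0.
Proof.
by move/ctx_eq0E=> e; split; apply: ctx_eqE => i;
  move: (e i); rewrite /ctx_add /ctx0; case: (G i) => //= -> .
Qed.

Lemma ctx_add_eq (G G' D D' : ctx) :
  ctx_eq G G' -> ctx_eq D D' -> ctx_eq (ctx_add G D) (ctx_add G' D').
Proof. by move=> h1 h2 i; apply: meq_cat => //; apply: aeq_refl. Qed.

Lemma ctx_scale_eq u (G G' : ctx) :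
  ctx_eq G G' -> ctx_eq (ctx_scale u G) (ctx_scale u G').
Proof. by move=> h i; apply: meq_scale. Qed.

Lemma scale_cat T u (s t : wlist T) : scale u (s ++ t) = scale u s ++ scale u t.
Proof. exact: map_cat. Qed.

Lemma scale_scale T u v (s : wlist T) : scale u (scale v s) = scale (u * v) s.
Proof. by rewrite /scale -map_comp; apply: eq_map => x /=; rewrite mulrA. Qed.

Lemma scale1 T (s : wlist T) : scale 1 s = s.
Proof. by elim: s => [|[q x] s IH] //=; rewrite mul1r IH. Qed.

Lemma unit_factorM u q : unit_factor u -> unit_factor q -> unit_factor (u * q).
Proof.
move=> /andP[u0 u1] /andP[q0 q1].
by rewrite /unit_factor mulr_gt0 // mulr_ile1 // ltW.
Qed.

(** * List forms of the rules with indexed premises *)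

Definition ord_cons {n T} (x : T) (f : 'I_n -> T) (i : 'I_n.+1) : T :=
  oapp f x (unlift ord0 i).

Lemma ord_cons0 n T (x : T) (f : 'I_n -> T) : ord_cons x f ord0 = x.
Proof. by rewrite /ord_cons unlift_none. Qed.

Lemma ord_consS n T (x : T) (f : 'I_n -> T) j :
  ord_cons x f (lift ord0 j) = f j.
Proof. by rewrite /ord_cons liftK. Qed.

Lemma wsum_ord_cons n T u s (f : 'I_n -> rat) (g : 'I_n -> wlist T) :
  wsum (ord_cons u f) (ord_cons s g) = scale u s ++ wsum f g.
Proof.
rewrite /wsum enum_ordSl /= !ord_cons0 -map_comp; congr (_ ++ flatten _).
by apply: eq_map => j /=; rewrite !ord_consS.
Qed.

Lemma wfam_ord_cons n T u x (f : 'I_n -> rat) (g : 'I_n -> T) :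
  wfam (ord_cons u f) (ord_cons x g) = (u, x) :: wfam f g.
Proof.
rewrite /wfam enum_ordSl /= !ord_cons0 -map_comp; congr (_ :: _).
by apply: eq_map => j /=; rewrite !ord_consS.
Qed.

Lemma ctx_wsum_ord_cons n u D (f : 'I_n -> rat) (g : 'I_n -> ctx) :
  ctx_wsum (ord_cons u f) (ord_cons D g) =1
  ctx_add (ctx_scale u D) (ctx_wsum f g).
Proof.
move=> i; rewrite /ctx_add /ctx_scale /ctx_wsum -wsum_ord_cons /wsum.
congr flatten; apply: eq_map => k; congr scale.
by rewrite /ord_cons; case: unlift.
Qed.

(* List presentation of the premises of rule (!), to allow induction on them. *)
Inductive bang (V : value) : ctx -> rat -> ity -> Prop :=
  | bang_nil G : ctx_eq ctx0 G -> bang V G 0 [::]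
  | bang_cons G D E w v q A M :
      unit_factor q -> ahas G w V A -> bang V D v M ->
      ctx_eq (ctx_add (ctx_scale q G) D) E ->
      bang V E (q * w + v) ((q, A) :: M).

Lemma bang_eq V G G' w M : ctx_eq G G' -> bang V G w M -> bang V G' w M.
Proof.
move=> e h; case: h e => {G w M}.
  by move=> G e0 e; apply: bang_nil; apply: ctx_eq_trans e.
move=> G D E w v q A M hq hA hM e0 e.
by apply: (bang_cons _ G D) => //; apply: ctx_eq_trans e.
Qed.

Lemma ihas_of_bang V G w M : bang V G w M -> ihas G w V M.
Proof.
move=> h.
suff [n [q [D [v [A [hq hA eG -> ->]]]]]] : exists n (q : 'I_n -> rat)
    (D : 'I_n -> ctx) (v : 'I_n -> rat) (A : 'I_n -> aty),
    [/\ forall i, unit_factor (q i), forall i, ahas (D i) (v i) V (A i),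
      ctx_eq (ctx_wsum q D) G, w = \sum_i q i * v i & M = wfam q A].
  apply: ihas_eq eG (ieq_refl _) _; exact: ihas_bang.
elim: h => {G w M} [G e|G D E w v q A M hq hA _ IH e].
  (* The index set is empty, so the families are arbitrary. *)
  exists 0%N, (fun=> 1), (fun=> ctx0), (fun=> 0), (fun=> Arr [::] [::]).
  split; try by case.
  - by apply: ctx_eq_trans e; apply: ctx_eqE => i; rewrite /ctx_wsum /wsum enum_ord0.
  - by rewrite big_ord0.
  - by rewrite /wfam enum_ord0.
case: IH => n [f [D' [v' [A' [hf hA' eG -> ->]]]]].
exists n.+1, (ord_cons q f), (ord_cons G D'), (ord_cons w v'),
  (ord_cons A A'); split.
- by move=> i; rewrite /ord_cons; case: unlift.
- by move=> i; rewrite /ord_cons; case: unlift.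
- apply: ctx_eq_trans (ctx_eqE _ _ (ctx_wsum_ord_cons _ _ _ _ _)) _.
  by apply: ctx_eq_trans e; apply: ctx_add_eq => //; apply: ctx_eq_refl.
- rewrite big_ord_recl !ord_cons0; congr (_ + _).
  by apply: eq_bigr => j _; rewrite !ord_consS.
- by rewrite wfam_ord_cons.
Qed.

(** Restricted to abstractions because [ihas_var] types a variable without any [ahas] premise to
    collect. Multiset equality on the type stays outside, since [bang] absorbs only equality of
    contexts. *)
Lemma ihas_lam_inv G w N M :
  ihas G w (vLam N) M -> exists2 M', bang (vLam N) G w M' & ieq M' M.
Proof.
move eV: (vLam N) => V h; elim: h eV => {G w V M} //.
- move=> n q G w V A hq hA _; exists (wfam q A); last exact: ieq_refl.
  rewrite /ctx_wsum /wsum /wfam -big_enum /=.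
  elim: (enum _) => [|k r IH] /=.
    by rewrite big_nil; apply: bang_nil; apply: ctx_eq_refl.
  rewrite big_cons; apply: (bang_cons _ (G k)) => //; first exact: IH.
  exact: ctx_eqE.
- move=> G G' w V M M' eG eM _ IH /IH [M0 h0 e0].
  by exists M0; [apply: bang_eq h0 | apply: meq_trans eM].
Qed.

Lemma bang_cat V G D w v M M' :
  bang V G w M -> bang V D v M' -> bang V (ctx_add G D) (w + v) (M ++ M').
Proof.
move=> h; elim: h D v M' => {G w M} [G e|G D E w v q A M hq hA _ IH e] F u M' hM'.
  rewrite add0r; apply: bang_eq hM'.
  by apply: (ctx_add_eq _ _ _ _ e (ctx_eq_refl F)).
rewrite -addrA /=; apply: (bang_cons _ G _ _ _ _ _ _ _ hq hA (IH _ _ _ hM')).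
apply: ctx_eq_trans (ctx_add_eq _ _ _ _ e (ctx_eq_refl F)).
by apply: ctx_eqE => i; rewrite /ctx_add catA.
Qed.

Lemma bang_scale V u G w M :
  unit_factor u -> bang V G w M ->
  bang V (ctx_scale u G) (u * w) (scale u M).
Proof.
move=> hu; elim=> {G w M} [G e|G D E w v q A M hq hA _ IH e].
  by rewrite mulr0; apply: bang_nil; apply: (ctx_scale_eq u _ _ e).
rewrite mulrDr mulrA /=.
apply: (bang_cons _ G _ _ _ _ _ _ _ _ hA IH); first exact: unit_factorM.
apply: ctx_eq_trans (ctx_scale_eq u _ _ e).
by apply: ctx_eqE => i; rewrite /ctx_add /ctx_scale scale_cat scale_scale.
Qed.

Lemma ihas_cat G D w v N M M' :
  ihas G w (vLam N) M -> ihas D v (vLam N) M' ->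
  ihas (ctx_add G D) (w + v) (vLam N) (M ++ M').
Proof.
move=> /ihas_lam_inv[M0 h0 e0] /ihas_lam_inv[M1 h1 e1].
apply: ihas_eq (ctx_eq_refl _) (meq_cat aeq_refl _ _ _ _ e0 e1) _.
exact: ihas_of_bang (bang_cat _ _ _ _ _ _ _ h0 h1).
Qed.

Lemma ihas_scale u G w N M :
  unit_factor u -> ihas G w (vLam N) M ->
  ihas (ctx_scale u G) (u * w) (vLam N) (scale u M).
Proof.
move=> hu /ihas_lam_inv[M0 h0 e0].
apply: ihas_eq (ctx_eq_refl _) (meq_scale u _ _ e0) _.
exact: ihas_of_bang (bang_scale _ _ _ _ _ hu h0).
Qed.

Lemma ihas_nil V : ihas ctx0 0 V [::].
Proof. exact: ihas_of_bang (bang_nil _ _ (ctx_eq_refl _)). Qed.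

(* The same presentation for the premises of rule (let) on the body [M]: the
   first type distribution is that of the bound term. *)
Inductive lets (M : term) : dty -> ctx -> rat -> dty -> Prop :=
  | lets_nil G : ctx_eq ctx0 G -> lets M [::] G 0 [::]
  | lets_cons p T a D E F w v b c d :
      unit_factor p -> dhas (ctx_cons T D) w M b -> lets M a E v c ->
      ctx_eq (ctx_add (ctx_scale p D) E) F -> deq (scale p b ++ c) d ->
      lets M ((p, T) :: a) F (p * w + v) d.

Lemma lets_eq M a G G' w b b' :
  ctx_eq G G' -> deq b b' -> lets M a G w b -> lets M a G' w b'.
Proof.
move=> eG eb h; case: h eG eb => {a G w b}.
  move=> G e0 eG /meq_nil_l ->; apply: lets_nil; exact: ctx_eq_trans eG.
move=> p T a D E F w v b c d hp hb hc e0 eb0 e eb.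
apply: (lets_cons _ _ _ _ _ _ _ _ _ _ _ _ hp hb hc).
  exact: ctx_eq_trans e.
exact: meq_trans eb.
Qed.

Lemma lets_cat M a a' G D w v b b' :
  lets M a G w b -> lets M a' D v b' ->
  lets M (a ++ a') (ctx_add G D) (w + v) (b ++ b').
Proof.
move=> h; elim: h a' D v b' => {a G w b}.
  move=> G e a' D v b' h; rewrite add0r; apply: lets_eq (deq_refl _) h.
  by apply: (ctx_add_eq _ _ _ _ e (ctx_eq_refl D)).
move=> p T a D E F w v b c d hp hb _ IH e eb a' H u b' h.
rewrite -addrA; apply: (lets_cons _ _ _ _ _ _ _ _ _ _ _ _ hp hb (IH _ _ _ _ h)).
  apply: ctx_eq_trans (ctx_add_eq _ _ _ _ e (ctx_eq_refl H)).
  by apply: ctx_eqE => i; rewrite /ctx_add catA.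
by rewrite catA; apply: meq_cat => //; [apply: ieq_refl | apply: deq_refl].
Qed.

Lemma lets_scale M u a G w b :
  unit_factor u -> lets M a G w b ->
  lets M (scale u a) (ctx_scale u G) (u * w) (scale u b).
Proof.
move=> hu; elim=> {a G w b}.
  by move=> G e; rewrite mulr0; apply: lets_nil; apply: (ctx_scale_eq u _ _ e).
move=> p T a D E F w v b c d hp hb _ IH e eb.
rewrite mulrDr mulrA /=.
apply: (lets_cons _ _ _ _ _ _ _ _ _ _ _ _ _ hb IH); first exact: unit_factorM.
  apply: ctx_eq_trans (ctx_scale_eq u _ _ e).
  by apply: ctx_eqE => i; rewrite /ctx_add /ctx_scale scale_cat scale_scale.
by rewrite -scale_scale -scale_cat; apply: meq_scale.
Qed.

(** This turns the list of premises back into indexed families; the equalities stored along the list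
    are paid for by one final [dhas_eq]. *)
Lemma dhas_let_lets G v N a M D w b :
  dhas G v N a -> lets M a D w b ->
  dhas (ctx_add G D) (w + v + 1) (tLet N M) b.
Proof.
move=> hN h.
suff [n [p [T [E [u [c [ea hu eD -> eb]]]]]]] : exists n (p : 'I_n -> rat)
    (T : 'I_n -> ity) (E : 'I_n -> ctx) (u : 'I_n -> rat) (c : 'I_n -> dty),
    [/\ a = wfam p T, forall k, dhas (ctx_cons (T k) (E k)) (u k) M (c k),
      ctx_eq (ctx_wsum p E) D, w = \sum_k p k * u k & deq (wsum p c) b].
  apply: dhas_eq (ctx_add_eq _ _ _ _ (ctx_eq_refl G) eD) eb _.
  by apply: dhas_let hu; rewrite -ea.
elim: h {hN} => {a D w b} [D e|p T a D E F w v' b c d hp hb _ IH e eb].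
  exists 0%N, (fun=> 1), (fun=> [::]), (fun=> ctx0), (fun=> 0), (fun=> [::]).
  split; try by case.
  - by rewrite /wfam enum_ord0.
  - by apply: ctx_eq_trans e; apply: ctx_eqE => i; rewrite /ctx_wsum /wsum enum_ord0.
  - by rewrite big_ord0.
  - by rewrite /wsum enum_ord0; apply: deq_refl.
case: IH => n [f [T' [D' [u [c' [-> hu eE -> ec]]]]]].
exists n.+1, (ord_cons p f), (ord_cons T T'), (ord_cons D D'),
  (ord_cons w u), (ord_cons b c'); split.
- by rewrite wfam_ord_cons.
- by move=> i; rewrite /ord_cons; case: unlift.
- apply: ctx_eq_trans (ctx_eqE _ _ (ctx_wsum_ord_cons _ _ _ _ _)) _.
  by apply: ctx_eq_trans e; apply: ctx_add_eq => //; apply: ctx_eq_refl.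
- rewrite big_ord_recl !ord_cons0; congr (_ + _).
  by apply: eq_bigr => j _; rewrite !ord_consS.
- rewrite wsum_ord_cons; apply: meq_trans eb.
  by apply: meq_cat => //; [apply: ieq_refl | apply: deq_refl].
Qed.

(** * Inversion of typing derivations *)

(** Derivations whose last rule is not [dhas_eq], with the body premises of (let) in list form. Only
    the last rule is normalized; the premises are ordinary derivations. *)
Inductive dhas_rule : ctx -> rat -> term -> dty -> Prop :=
  | rule_zero M : dhas_rule ctx0 0 M [::]
  | rule_val G w V M : ihas G w V M -> dhas_rule G w (tVal V) [:: (1, M)]
  | rule_app G D w v V W M b :
      ihas G w V [:: (1, Arr M b)] -> ihas D v W M ->
      dhas_rule (ctx_add G D) (w + v) (tApp V W) b
  | rule_plus G D w v M N a b :
      dhas G w M a -> dhas D v N b ->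
      dhas_rule (ctx_add (ctx_scale 2^-1 G) (ctx_scale 2^-1 D))
        (2^-1 * w + 2^-1 * v + 1) (tPlus M N) (scale 2^-1 a ++ scale 2^-1 b)
  | rule_let G D v w N a M b :
      dhas G v N a -> lets M a D w b ->
      dhas_rule (ctx_add G D) (w + v + 1) (tLet N M) b.

Lemma dhas_inv G w M a : dhas G w M a ->
  exists G' a', [/\ dhas_rule G' w M a', ctx_eq G' G & deq a' a].
Proof.
elim=> {G w M a}.
- by move=> M; exists ctx0, [::]; split;
    [constructor | apply: ctx_eq_refl | apply: deq_refl].
- by move=> G w V M h; exists G, [:: (1, M)]; split;
    [constructor | apply: ctx_eq_refl | apply: deq_refl].
- move=> G D w v V W M b hV hW; exists (ctx_add G D), b.
  by split; [apply: rule_app hV hW | apply: ctx_eq_refl | apply: deq_refl].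
- move=> G D w v M N a b hM _ hN _; eexists _, _.
  by split; [apply: rule_plus hM hN | apply: ctx_eq_refl | apply: deq_refl].
- move=> n p T G v N D w M b hN _ hM _; eexists _, _.
  split; [|apply: ctx_eq_refl|apply: deq_refl].
  (* [dhas_let] does not bound its factors, but [lets_cons] does; the bound comes from the
     well-formedness of the type of [N]. *)
  have hp k : unit_factor (p k).
    have [_ _ /(_ _ _ _ _ hN)[_ /andP[+ _]]] := typing_wf.
    by rewrite all_map => /allP/(_ k); rewrite mem_enum => /(_ isT) /andP[].
  apply: rule_let hN _; rewrite /ctx_wsum /wsum /wfam -big_enum /=.
  elim: (enum _) => [|k r IH] /=.
    by rewrite big_nil; apply: lets_nil; apply: ctx_eq_refl.
  rewrite big_cons; apply: (lets_cons _ _ _ _ _ _ _ _ _ _ _ _ (hp k) (hM k) IH).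
    exact: ctx_eqE.
  exact: deq_refl.
- move=> G G' w M a a' eG ea _ [G0 [a0 [h0 e0 ea0]]].
  exists G0, a0; split=> //; [exact: ctx_eq_trans eG | exact: meq_trans ea].
Qed.

Lemma ahas_inv G w N A : ahas G w (vLam N) A ->
  exists G' M b v, [/\ dhas (ctx_cons M G') v N b, w = v + 1,
    ctx_eq G' G & aeq (Arr M b) A].
Proof.
move eV: (vLam N) => V h; elim: h eV => {G w V A}.
- move=> G w N' M b h [->]; exists G, M, b, w; split=> //.
    exact: ctx_eq_refl.
  exact: aeq_refl.
- move=> G G' w V A A' eG eA _ IH /IH[G0 [M [b [v [h -> e0 eA0]]]]].
  exists G0, M, b, v; split=> //; first exact: ctx_eq_trans eG.
  exact: aeq_trans eA.
Qed.

(** * Closed values and the support of contexts *)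

(** With [n = 0], a closed value is invariant under the renamings that [up_sub] performs when a
    substitution passes a binder. *)
Lemma ren_scoped_id :
  (forall V n r, (forall i, (i < n)%N -> r i = i) ->
     scoped_val n V -> ren_val r V = V) /\
  (forall M n r, (forall i, (i < n)%N -> r i = i) ->
     scoped_term n M -> ren_term r M = M).
Proof.
have up n r : (forall i, (i < n)%N -> r i = i) ->
  forall i, (i < n.+1)%N -> up_ren r i = i.
  by move=> hr [|i] //= /hr ->.
apply: value_term_ind => /=.
- by move=> i n r hr /hr ->.
- by move=> M IH n r /up hr /(IH _ _ hr) ->.
- by move=> V IH n r hr /(IH _ _ hr) ->.
- by move=> V IHV W IHW n r hr /andP[/(IHV _ _ hr) -> /(IHW _ _ hr) ->].
- by move=> M IHM N IHN n r hr /andP[/(IHM _ _ hr) -> /(IHN _ _ hr) ->].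
- by move=> N IHN M IHM n r hr /andP[/(IHN _ _ hr) -> /(IHM _ _ (up _ _ hr)) ->].
Qed.

Lemma wsum_nil n T (u : 'I_n -> rat) (s : 'I_n -> wlist T) :
  (forall k, s k = [::]) -> wsum u s = [::].
Proof. by move=> h; rewrite /wsum; elim: (enum _) => //= k r ->; rewrite h. Qed.

(** There is no weakening: nonempty entries originate in (Var) only. In particular every typing of a
    closed value has an empty context. *)
Lemma typing_scoped :
  [/\ forall G w V A, ahas G w V A ->
       forall n i, scoped_val n V -> (n <= i)%N -> G i = [::],
     forall G w V M, ihas G w V M ->
       forall n i, scoped_val n V -> (n <= i)%N -> G i = [::]
   & forall G w M a, dhas G w M a ->
       forall n i, scoped_term n M -> (n <= i)%N -> G i = [::]].
Proof.
have ceq G G' i : ctx_eq G G' -> G i = [::] -> G' i = [::].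
  by move=> /(_ i) + e; rewrite e => /meq_nil_l.
suff [a [b c]] : (forall G w V A, ahas G w V A ->
       forall n i, scoped_val n V -> (n <= i)%N -> G i = [::]) /\
     (forall G w V M, ihas G w V M ->
       forall n i, scoped_val n V -> (n <= i)%N -> G i = [::]) /\
     (forall G w M a, dhas G w M a ->
       forall n i, scoped_term n M -> (n <= i)%N -> G i = [::]) by [].
apply: has_ind.
- by move=> G w N M b _ IH n i /= hN hi; apply: (IH n.+1 i.+1).
- move=> G G' w V A A' e _ _ IH n i hV hi; apply: ceq e _; exact: IH hV hi.
- move=> x M _ n i /= hx hi; rewrite /ctx1; case: eqP => // e.
  by move: (leq_trans hx hi); rewrite e ltnn.
- by move=> n q G w V A _ _ IH k i hV hi; apply: wsum_nil => j; apply: IH hV hi.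
- move=> G G' w V A A' e _ _ IH n i hV hi; apply: ceq e _; exact: IH hV hi.
- by [].
- by move=> G w V M _ IH n i /= hV hi; apply: IH hV hi.
- move=> G D w v V W M b _ IHV _ IHW n i /= /andP[hV hW] hi.
  by rewrite /ctx_add (IHV _ _ hV hi) (IHW _ _ hW hi).
- move=> G D w v M N a b _ IHM _ IHN n i /= /andP[hM hN] hi.
  by rewrite /ctx_add /ctx_scale (IHM _ _ hM hi) (IHN _ _ hN hi).
- move=> n p T G v N D w M b _ IHN _ IHM k i /= /andP[hN hM] hi.
  rewrite /ctx_add (IHN _ _ hN hi) /=; apply: wsum_nil => j.
  exact: (IHM j k.+1 i.+1).
- move=> G G' w V A A' e _ _ IH n i hV hi; apply: ceq e _; exact: IH hV hi.
Qed.

(** * Anti-substitution *)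

(** Below [n] binders the substituted variable has index [n]. It is the largest index in scope, so
    its entry can be overwritten without shifting any other. *)
Definition ctx_set (n : nat) (T : ity) (G : ctx) : ctx :=
  fun i => if i == n then T else G i.

Lemma ctx_set_eq n T (G G' : ctx) :
  ctx_eq G G' -> ctx_eq (ctx_set n T G) (ctx_set n T G').
Proof. by move=> e i; rewrite /ctx_set; case: ifP => // _; apply: ieq_refl. Qed.

Lemma ctx_set_nil n (G : ctx) : G n = [::] -> ctx_eq G (ctx_set n [::] G).
Proof. by move=> e; apply: ctx_eqE => i; rewrite /ctx_set; case: eqP => [->|]. Qed.

Lemma ctx_set_add n T T' G D :
  ctx_add (ctx_set n T G) (ctx_set n T' D) =1 ctx_set n (T ++ T') (ctx_add G D).
Proof. by move=> i; rewrite /ctx_add /ctx_set; case: eqP. Qed.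

Lemma ctx_set_scale n T u G :
  ctx_scale u (ctx_set n T G) =1 ctx_set n (scale u T) (ctx_scale u G).
Proof. by move=> i; rewrite /ctx_scale /ctx_set; case: eqP. Qed.

Lemma ctx_set_cons n T M G :
  ctx_set n.+1 T (ctx_cons M G) =1 ctx_cons M (ctx_set n T G).
Proof. by case. Qed.

Section AntiSubstitution.
Context (N0 : term) (cV : scoped_val 0 (vLam N0)).
Local Notation V := (vLam N0).

(* [J] is a judgment about a term with the free variable [n], whose instance
   with [V] for [n] has been typed in [G] with weight [w]. *)
Definition splits (n : nat) (J : ctx -> rat -> Prop) (G : ctx) (w : rat) :=
  exists T w1 w2,
    [/\ J (ctx_set n T G) w1, ihas ctx0 w2 V T & w = w1 + w2].

(** Only indices up to [n] are constrained, matching terms of scope [n.+1]; the substitution of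
    [subst0] satisfies this for [n = 0]. *)
Definition substitutes (n : nat) (s : nat -> value) :=
  (forall i, (i < n)%N -> s i = vVar i) /\ s n = V.

Lemma substitutes_up n s : substitutes n s -> substitutes n.+1 (up_sub s).
Proof.
move=> [h1 h2]; split; first by case=> //= i /h1 ->.
by rewrite /= h2; apply: ren_scoped_id.1 cV.
Qed.

Lemma splits_eq n (J : ctx -> rat -> Prop) G G' w :
  (forall H H' u, ctx_eq H H' -> J H u -> J H' u) ->
  ctx_eq G G' -> splits n J G w -> splits n J G' w.
Proof.
move=> hJ e [T [w1 [w2 [h1 h2 ->]]]]; exists T, w1, w2; split=> //.
by apply: hJ h1; apply: ctx_set_eq.
Qed.

(** The variable receives the empty intersection type, at which [V] is typed with weight 0 by (!)
    without premises. *)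
Lemma splits0 n (J : ctx -> rat -> Prop) G w :
  (forall H H' u, ctx_eq H H' -> J H u -> J H' u) ->
  G n = [::] -> J G w -> splits n J G w.
Proof.
move=> hJ e h; exists [::], w, 0; rewrite addr0; split=> //.
  by apply: hJ h; apply: ctx_set_nil.
exact: ihas_nil.
Qed.

Lemma splits_imp n (J J' : ctx -> rat -> Prop) G w :
  (forall H u, J H u -> J' H u) -> splits n J G w -> splits n J' G w.
Proof.
move=> hJ [T [w1 [w2 [h1 h2 ->]]]]; exists T, w1, w2; split=> //; exact: hJ.
Qed.

Lemma splits_weight n (J J' : ctx -> rat -> Prop) G w c :
  (forall H u, J H u -> J' H (u + c)) ->
  splits n J G w -> splits n J' G (w + c).
Proof.
move=> hJ [T [w1 [w2 [h1 h2 ->]]]]; exists T, (w1 + c), w2; split=> //.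
  exact: hJ.
by rewrite addrAC.
Qed.

(** A scaled premise is not itself a typing judgment, so the new judgment just remembers the premise
    before scaling. [splits_add] later hands it to the rule that does the scaling. *)
Lemma splits_scale n u (J : ctx -> rat -> Prop) G w :
  unit_factor u -> splits n J G w ->
  splits n (fun H v => exists H' v',
      [/\ J H' v', v = u * v' & ctx_eq (ctx_scale u H') H])
    (ctx_scale u G) (u * w).
Proof.
move=> hu [T [w1 [w2 [h1 h2 ->]]]]; exists (scale u T), (u * w1), (u * w2).
split; last by rewrite mulrDr.
  exists (ctx_set n T G), w1; split=> //.
  exact: ctx_eqE (ctx_set_scale _ _ _ _).
exact: (ihas_scale _ _ _ _ _ hu h2).
Qed.

Lemma splits_add n (J1 J2 J : ctx -> rat -> Prop) G D w v :
  (forall H H' u, ctx_eq H H' -> J H u -> J H' u) ->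
  (forall H1 H2 x y, J1 H1 x -> J2 H2 y -> J (ctx_add H1 H2) (x + y)) ->
  splits n J1 G w -> splits n J2 D v -> splits n J (ctx_add G D) (w + v).
Proof.
move=> hJ h [T [w1 [w2 [h1 h2 ->]]]] [U [v1 [v2 [k1 k2 ->]]]].
exists (T ++ U), (w1 + v1), (w2 + v2); split; last by rewrite addrACA.
  by apply: hJ (h _ _ _ _ h1 k1); apply: ctx_eqE (ctx_set_add _ _ _ _ _).
exact: (ihas_cat _ _ _ _ _ _ _ h2 k2).
Qed.

(** Each typed copy of [V] in the instance supplies the type of one occurrence of the variable. The
    rules scale contexts and weights by the same factors, so the types of the copies unite to [T]
    and their weights sum exactly to [w2]. The induction is on the term, with inner inductions on
    the premises of (!) and (let). *)
Lemma anti_substitution :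
  (forall W n s G w M, substitutes n s -> scoped_val n.+1 W ->
     ihas G w (sub_val s W) M -> splits n (fun H u => ihas H u W M) G w) /\
  (forall P n s G w b, substitutes n s -> scoped_term n.+1 P ->
     dhas G w (sub_term s P) b -> splits n (fun H u => dhas H u P b) G w).
Proof.
have [_ supp_val _] := typing_scoped.
have ieqJ W M H H' u : ctx_eq H H' -> ihas H u W M -> ihas H' u W M.
  by move=> e; apply: ihas_eq e (ieq_refl _).
have deqJ P b H H' u : ctx_eq H H' -> dhas H u P b -> dhas H' u P b.
  by move=> e; apply: dhas_eq e (deq_refl _).
have inv n P Q G w b :
    (forall G' b', dhas_rule G' w P b' ->
       splits n (fun H u => dhas H u Q b') G' w) ->
    dhas G w P b -> splits n (fun H u => dhas H u Q b) G w.
  move=> hQ /dhas_inv[G' [b' [hr eG eb]]].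
  apply: splits_eq eG _; first exact: deqJ.
  by apply: splits_imp (hQ _ _ hr) => H u; apply: dhas_eq (ctx_eq_refl _) eb.
(* This settles the (Zero) case of every term constructor below: [Q] is itself typed by (Zero). *)
have zero n Q : splits n (fun H u => dhas H u Q [::]) ctx0 0.
  by apply: splits0; [exact: deqJ | | exact: dhas_zero].
apply: value_term_ind => /=.
- move=> x n s G w M [hs1 hs2]; rewrite ltnS leq_eqVlt.
  case/orP=> [/eqP->|xn]; last first.
    rewrite hs1 // => h; apply: splits0; [exact: ieqJ | | exact: h].
    by apply: (supp_val _ _ _ _ h x.+1) => /=.
  rewrite hs2 => h; have hG i : G i = [::] by apply: (supp_val _ _ _ _ h 0%N).
  (* At the substituted variable, (Var) weighs 0 and the whole weight belongs to [V], whose context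
     is empty because [V] is closed. *)
  exists M, 0, w; rewrite add0r; split=> //.
    have wM : wf_ity M by have [_ /(_ _ _ _ _ h)[]] := typing_wf.
    apply: (ieqJ _ _ _ _ _ _ (ihas_var n wM)).
    by apply: ctx_eqE => i; rewrite /ctx_set /ctx1 hG.
  by apply: ieqJ h; apply: ctx_eqE.
- move=> P IH n s G w M hs hP /ihas_lam_inv[M' h e].
  suff : splits n (fun H u => ihas H u (vLam P) M') G w.
    by apply: splits_imp => H u; apply: ihas_eq (ctx_eq_refl _) e.
  elim: h => {G w M M' e} [G e|G D E w v q A M hq hA _ IHM e].
    apply: splits_eq e _; first exact: ieqJ.
    by apply: splits0; [exact: ieqJ | | apply: ihas_nil].
  apply: splits_eq e _; first exact: ieqJ.
  have [G' [T [b [u [hb -> eG eA]]]]] := ahas_inv _ _ _ _ hA.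
  have {}hA : splits n (fun H u => ahas H u (vLam P) A) G (u + 1).
    have [U [w1 [w2 [h1 h2 ->]]]] := IH _ _ _ _ _ (substitutes_up _ _ hs) hP hb.
    exists U, (w1 + 1), w2; split=> //; last by rewrite addrAC.
    apply: ahas_eq (ctx_set_eq _ _ _ _ eG) eA _; apply: ahas_lam.
    by apply: deqJ h1; apply: ctx_eqE (ctx_set_cons _ _ _ _).
  apply: splits_add (splits_scale _ _ _ _ _ hq hA) IHM; first exact: ieqJ.
  move=> H1 H2 x y [H [z [hz -> eH]]] h2.
  (* The new premise is seen as an instance of (!) with one premise and joined to the others by
     [ihas_cat]. *)
  rewrite -cat1s; apply: ieqJ (ctx_add_eq _ _ _ _ eH (ctx_eq_refl _)) _.
  apply: ihas_cat h2; apply: ihas_of_bang; rewrite -[q * z]addr0.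
  apply: (bang_cons _ H ctx0) hz _ _ => //.
    exact: bang_nil (ctx_eq_refl _).
  by apply: ctx_eqE => i; rewrite /ctx_add cats0.
- move=> W IH n s G w b hs hW; apply: inv => {G b} G b.
  move eP: (tVal _) => P h; case: h eP => // {G w P b} G w V' M h [eV].
  rewrite -eV in h; apply: splits_imp (IH _ _ _ _ _ hs hW h).
  by move=> H u; apply: dhas_val.
- move=> W IHW U IHU n s G w b hs /andP[hW hU]; apply: inv => {G b} G b.
  move eP: (tApp _ _) => P h; case: h eP => // {G w P b}.
  move=> G D w v V1 V2 M b h1 h2 [e1 e2]; rewrite -e1 in h1; rewrite -e2 in h2.
  apply: splits_add (IHW _ _ _ _ _ hs hW h1) (IHU _ _ _ _ _ hs hU h2).
    exact: deqJ.
  by move=> H1 H2 x y; apply: dhas_app.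
- move=> P IHP Q IHQ n s G w b hs /andP[hP hQ]; apply: inv => {G b} G b.
  move eP: (tPlus _ _) => P' h; case: h eP => // {G w P' b}.
  move=> G D w v M1 M2 b c h1 h2 [e1 e2]; rewrite -e1 in h1; rewrite -e2 in h2.
  have k1 := splits_scale n 2^-1 _ _ _ isT (IHP _ _ _ _ _ hs hP h1).
  have k2 := splits_scale n 2^-1 _ _ _ isT (IHQ _ _ _ _ _ hs hQ h2).
  (* The constant 1 of the rule is moved into [J], so that what remains is the plain sum of two
     premises that [splits_add] expects. *)
  pose J (H : ctx) u := dhas H (u + 1) (tPlus P Q) (scale 2^-1 b ++ scale 2^-1 c).
  apply: (splits_weight n J) => //; apply: splits_add k1 k2.
    by move=> H H' u; apply: deqJ.
  move=> H1 H2 x y [H1' [x' [hx -> eH1]]] [H2' [y' [hy -> eH2]]].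
  by apply: deqJ (dhas_plus hx hy); apply: ctx_add_eq.
- move=> N IHN P IHP n s G w b hs /andP[hN hP]; apply: inv => {G b} G b.
  move eP: (tLet _ _) => P' h; case: h eP => // {G w P' b}.
  move=> G D v w N' a P' b h1 h2 [e1 e2]; rewrite -e1 in h1; rewrite -e2 in h2.
  pose J (H : ctx) u := dhas H (u + 1) (tLet N P) b.
  apply: (splits_weight n J) => //; rewrite [w + v]addrC.
  have k1 := IHN _ _ _ _ _ hs hN h1.
  suff k2 : splits n (fun H u => lets P a H u b) D w.
    apply: splits_add k1 k2; first by move=> H H' u; apply: deqJ.
    by move=> H1 H2 x y hx hy; rewrite /J [x + y]addrC; apply: dhas_let_lets hy.
  have letsJ a' b' H H' u : ctx_eq H H' -> lets P a' H u b' -> lets P a' H' u b'.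
    by move=> e; apply: lets_eq e (deq_refl _).
  elim: h2 => {h1 k1 a D w b J} [D e|p T a D E F w u b c d hp hb _ IH e eb].
    apply: splits_eq e _; first exact: letsJ.
    by apply: splits0; [exact: letsJ | | apply: lets_nil; apply: ctx_eq_refl].
  apply: splits_eq e _; first exact: letsJ.
  have {}hb : splits n (fun H u => dhas (ctx_cons T H) u P b) D w.
    have := IHP _ _ _ _ _ (substitutes_up _ _ hs) hP hb.
    move=> [U [w1 [w2 [h1 h2 ->]]]]; exists U, w1, w2; split=> //.
    by apply: deqJ h1; apply: ctx_eqE (ctx_set_cons _ _ _ _).
  apply: splits_add (splits_scale _ _ _ _ _ hp hb) IH; first exact: letsJ.
  move=> H1 H2 x y [H1' [x' [hx -> eH1]]] hy.
  apply: (lets_cons _ _ _ _ _ _ _ _ _ _ _ _ hp hx hy _ eb).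
  exact: ctx_add_eq (ctx_eq_refl _).
Qed.

End AntiSubstitution.

Lemma closed_val_lam V : scoped_val 0 V -> exists N, V = vLam N.
Proof. by case: V => // N _; exists N. Qed.

Lemma subst0_typing P V w b :
  scoped_term 1 P -> scoped_val 0 V -> dhas ctx0 w (subst0 P V) b ->
  exists T w1 w2,
    [/\ dhas (ctx_cons T ctx0) w1 P b, ihas ctx0 w2 V T & w = w1 + w2].
Proof.
move=> hP hV; have [N eV] := closed_val_lam _ hV; rewrite {V}eV in hV * => h.
have [] := (anti_substitution _ hV).2 P 0%N _ _ _ _ _ hP h; first by split.
move=> T [w1 [w2 [h1 h2 e]]]; exists T, w1, w2; split=> //.
by apply: dhas_eq (deq_refl _) h1; apply: ctx_eqE => -[].
Qed.

(** * Typings of multidistributions *)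

(** One typing is chosen per entry, and types and weights are summed with the probabilities as
    factors. No multiset equality is built in, so the inversions below hold as equalities of
    lists. *)
Inductive mhas : mdist -> rat -> dty -> Prop :=
  | mhas_nil : mhas [::] 0 [::]
  | mhas_cons p M m w v a b :
      dhas ctx0 w M a -> mhas m v b ->
      mhas ((p, M) :: m) (p * w + v) (scale p a ++ b).

Lemma mhas_cons_inv p M m w a : mhas ((p, M) :: m) w a ->
  exists w1 a1 w2 a2, [/\ dhas ctx0 w1 M a1, mhas m w2 a2,
    w = p * w1 + w2 & a = scale p a1 ++ a2].
Proof. by move=> h; inversion h; subst; exists w0, a0, v, b. Qed.

Lemma mhas1E M w a : mhas [:: (1, M)] w a <-> dhas ctx0 w M a.
Proof.
split=> [/mhas_cons_inv[w1 [a1 [w2 [a2 [h1 h2 -> ->]]]]]|h].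
  by inversion h2; rewrite mul1r addr0 scale1 cats0.
have := mhas_cons 1 _ _ _ _ _ _ h mhas_nil.
by rewrite mul1r addr0 scale1 cats0.
Qed.

Lemma mhas_cat_scale_inv p m m' w a : mhas (scale p m ++ m') w a ->
  exists w1 a1 w2 a2, [/\ mhas m w1 a1, mhas m' w2 a2,
    w = p * w1 + w2 & a = scale p a1 ++ a2].
Proof.
elim: m w a => [|[q M] m IH] w a /=.
  move=> h; exists 0, [::], w, a; split=> //; first exact: mhas_nil.
  by rewrite mulr0 add0r.
case/mhas_cons_inv=> w1 [a1 [w2 [a2 [h1 /IH IH' -> ->]]]].
have [w3 [a3 [w4 [a4 [h3 h4 -> ->]]]]] := IH'.
exists (q * w1 + w3), (scale q a1 ++ a3), w4, a4; split=> //.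
- exact: mhas_cons.
- by ring.
- by rewrite scale_cat scale_scale catA.
Qed.

Definition mass (m : mdist) : rat := \sum_(x <- m) x.1.
Definition positive (m : mdist) : bool := all (fun x => 0 < x.1) m.

Lemma red_mass M m : red M m -> positive m /\ mass m = 1.
Proof.
elim=> {M m} [M V|V M|M N|N M m _ [h e]]; rewrite /mass ?big_seq1 //.
- by split=> //; rewrite !big_cons big_nil /=; field.
- by rewrite /positive all_map big_map.
Qed.

Lemma mass_ge0 m : positive m -> 0 <= mass m.
Proof.
rewrite /mass; elim: m => [|x m IH] /=; first by rewrite big_nil.
by case/andP=> hx /IH h; rewrite big_cons addr_ge0 // ltW.
Qed.

(* A derivation ending with (Zero), of weight 0, is replaced by one ending with
   (let), of weight 1. *)
Lemma dhas_let_inv w N M b : dhas ctx0 w (tLet N M) b ->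
  exists a v u, [/\ dhas ctx0 v N a, lets M a ctx0 u b & w <= u + v + 1].
Proof.
move=> /dhas_inv[G [b' [hr eG eb]]].
move eP: (tLet _ _) hr => P hr; case: hr eP eG eb => // {G w P b'}.
  move=> _ _ _ /meq_nil_l ->; exists [::], 0, 0; split=> //; first exact: dhas_zero.
  by apply: lets_nil; apply: ctx_eq_refl.
move=> G D v w N' a M' b' hN hM [-> ->] /ctx_add_eq0[eG eD] eb.
exists a, v, w; split=> //; first by apply: dhas_eq eG (deq_refl _) hN.
exact: lets_eq eD eb hM.
Qed.

(** The typings of the bound terms and those of the body are collected separately. Each reduct
    contributes the 1 of its own (let) times its probability, which makes [mass m] in total. *)
Lemma mhas_let_inv m M w b :
  positive m -> mass m <= 1 -> mhas [seq (x.1, tLet x.2 M) | x <- m] w b ->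
  exists a v u, [/\ mhas m v a, lets M a ctx0 u b & w <= u + v + mass m].
Proof.
elim: m w b => [|[p N] m IH] w b /=.
  move=> _ _ h; inversion h; exists [::], 0, 0; split; first exact: mhas_nil.
    by apply: lets_nil; apply: ctx_eq_refl.
  by rewrite /mass big_nil.
case/andP=> /= p0 pm; rewrite /mass big_cons -/(mass m) /= => p1.
have m0 := mass_ge0 _ pm.
case/mhas_cons_inv=> w1 [b1 [w2 [b2 [/dhas_let_inv[a1 [v1 [u1 [h1 k1 e1]]]]]]]].
case/(IH _ _ pm) => [|a2 [v2 [u2 [h2 k2 e2]]] -> ->]; first by lra.
exists (scale p a1 ++ a2), (p * v1 + v2), (p * u1 + u2); split.
- exact: mhas_cons.
(* [p <= 1] follows from [p + mass m <= 1] and [0 <= mass m]. *)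
- have hp : unit_factor p by rewrite /unit_factor p0 /=; lra.
  have := lets_cat _ _ _ _ _ _ _ _ _ (lets_scale _ _ _ _ _ _ hp k1) k2.
  by apply: lets_eq (deq_refl _); apply: ctx_eqE.
- have := ler_wpM2l (ltW p0) e1; lra.
Qed.

(** * Weighted subject expansion *)

(** The additional 1 comes from the rule for the contracted construct: ($\lambda$) for a beta step,
    (let) or ($\oplus$) otherwise. In the contextual case it comes from the induction hypothesis,
    because the (let) rules of the reducts have total weight [mass m = 1], just the 1 of the single
    (let) above them. *)
Lemma subject_expansion M m w a :
  red M m -> closed_term M -> mhas m w a ->
  exists2 w', 1 + w <= w' & dhas ctx0 w' M a.
Proof.
rewrite /closed_term => r; elim: r w a => {M m} [M V|V M|M N|N M m r IH] w a /=.
- case/andP=> hM hV /mhas1E/(subst0_typing _ _ _ _ hM hV).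
  move=> [T [w1 [w2 [h1 h2 ->]]]].
  (* [w1 + 1] is the weight after ($\lambda$); the factor 1 and the summand 0 come from (!) with one
     premise. *)
  exists ((1 * (w1 + 1) + 0) + w2); first by lra.
  apply: dhas_eq (deq_refl _) (dhas_app _ h2).
    exact: (ctx_eqE (ctx_add ctx0 ctx0)).
  apply: ihas_of_bang.
  apply: (bang_cons _ ctx0 ctx0) (ahas_lam h1) (bang_nil _ ctx0 _) _ => //;
    exact: ctx_eqE.
- case/andP=> hV hM /mhas1E/(subst0_typing _ _ _ _ hM hV).
  move=> [T [w1 [w2 [h1 h2 ->]]]].
  exists ((1 * w1 + 0) + w2 + 1); first by lra.
  suff h : lets M [:: (1, T)] ctx0 (1 * w1 + 0) a.
    apply: dhas_eq (deq_refl _) (dhas_let_lets _ _ _ _ _ _ _ _ (dhas_val h2) h).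
    exact: ctx_eqE.
  apply: (lets_cons _ _ _ _ ctx0 ctx0) h1 (lets_nil _ _ (ctx_eq_refl _)) _ _ => //.
    exact: ctx_eqE.
  by rewrite scale1 cats0; apply: deq_refl.
- move=> _ /mhas_cons_inv[w1 [a1 [w2 [a2 [h1 /mhas_cons_inv]]]]].
  move=> [w3 [a3 [w4 [a4 [h3 h4 -> ->]]]] -> ->]; inversion h4; rewrite cats0.
  exists (2^-1 * w1 + 2^-1 * w3 + 1); first by lra.
  by apply: dhas_eq (deq_refl _) (dhas_plus h1 h3); apply: ctx_eqE.
- case/andP=> hN hM; have [pm em] := red_mass _ _ r.
  case/mhas_let_inv => //; first by rewrite em.
  move=> b [v [u [/(IH _ _ hN)[v' lev h1] h2 le]]].
  exists (u + v' + 1); first by move: le lev; rewrite em; lra.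
  apply: dhas_eq (deq_refl _) (dhas_let_lets _ _ _ _ _ _ _ _ h1 h2).
  exact: ctx_eqE.
Qed.

(** * Expansion along the lifted reduction *)

Lemma mred_mass m m' : mred m m' ->
  positive m -> positive m' /\ mass m' = mass m.
Proof.
elim=> {m m'} // p M mi m m' h _ IH /andP[p0 /IH[pm' em']].
have [pi ei] : positive mi /\ mass mi = 1.
  by case: h => [V|N n _ /red_mass //]; rewrite /mass big_seq1.
split.
  rewrite /positive all_cat all_map; apply/andP; split=> //.
  by apply: sub_all pi => x /= x0; apply: mulr_gt0.
rewrite /mass big_cat big_cons big_map -mulr_sumr /=.
by rewrite -/(mass mi) ei mulr1 -/(mass m') em'.
Qed.

(** [closed_mred] provides some closed reduct, and determinism identifies it with [m']. *)
Lemma mred_closed m m' : mred m m' -> closed_mdist m -> closed_mdist m'.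
Proof. by move=> r /closed_mred[m1 /(mred_fun r) ->]. Qed.

(** A value is its own reduct and keeps its typing; a non-value of probability [p] gains at least 1
    by subject expansion, hence at least [p] in the sum. *)
Lemma mred_expansion m m' w a :
  mred m m' -> closed_mdist m -> positive m -> mhas m' w a ->
  exists2 w', \sum_(x <- m | ~~ is_value x.2) x.1 + w <= w' & mhas m w' a.
Proof.
move=> r; elim: r w a => {m m'} [|p M mi m m' h _ IH] w a.
  by move=> _ _ hm; exists w => //; rewrite big_nil add0r.
case/andP=> /= cM cm /andP[/= p0 pm] /mhas_cat_scale_inv.
move=> [w1 [a1 [w2 [a2 [h1 /(IH _ _ cm pm)[w3 le3 h3] -> ->]]]]].
rewrite big_cons /=; case: h cM h1 => [V _ /mhas1E h1|N n /= /negbTE eN r cN h1].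
  exists (p * w1 + w3) => /=; first by move: le3; lra.
  exact: mhas_cons.
have [w4 le4 h4] := subject_expansion _ _ _ _ r cN h1.
exists (p * w4 + w3); last exact: mhas_cons.
rewrite eN /=; have := ler_wpM2l (ltW p0) le4; move: le3; lra.
Qed.

(** The initial multidistribution is arbitrary so that the induction on [k] applies to the sequence
    shifted by one; this is why [mass (m 0%N)] stands where [expected_steps] has 1. *)
Lemma mdist_completeness k (m : nat -> mdist) :
  (forall j, mred (m j) (m j.+1)) -> closed_mdist (m 0%N) -> positive (m 0%N) ->
  exists w a, [/\ mhas (m 0%N) w a, tight a, dnorm a = val_prob m k
    & \sum_(j < k) (mass (m 0%N) - val_prob m j) <= w].
Proof.
elim: k m => [|k IH] m r c p.
  rewrite /val_prob; elim: (m 0%N) => [|[q M] m' [w [a [h1 h2 h3 h4]]]].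
    exists 0, [::]; rewrite /dnorm !big_nil big_ord0.
    by split=> //; apply: mhas_nil.
  rewrite big_ord0 in h4; rewrite big_ord0 big_cons /=.
  case: M => [V|V W|M N|N M] /=; last first.
  1-3: by exists (q * 0 + w), a; split=> //;
    [apply: (mhas_cons q _ _ _ _ [::]) h1; apply: dhas_zero | lra].
  exists (q * 0 + w), ((q * 1, [::]) :: a); split=> //; last by lra.
    apply: (mhas_cons q _ _ _ _ [:: (1, [::])]) h1.
    exact: dhas_val (ihas_nil V).
  by rewrite /dnorm big_cons /= mulr1 -h3.
have [p1 e1] := mred_mass _ _ (r 0%N) p.
have [] := IH (fun j => m j.+1) _ (mred_closed _ _ (r 0%N) c) p1.
  by move=> j; apply: r.
move=> w [a [h1 h2 h3 h4]].
have [w' le h] := mred_expansion _ _ _ _ (r 0%N) c p h1.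
exists w', a; split=> //; apply: le_trans le.
(* The summand for index 0 is the mass of the non-values of [m 0], gained in the last expansion. The
   others form the bound for the shifted sequence, whose mass is the same by [e1]. *)
rewrite big_ord_recl /=; apply: lerD; last by rewrite -e1.
by rewrite /mass /val_prob (bigID (fun x => is_value x.2)) /= addrAC subrr add0r.
Qed.

Theorem mainTheorem10 (M : term) (m : nat -> mdist) (k : nat) :
  closed_term M -> reduction_seq M m ->
  exists (w : rat) (a : dty),
    [/\ dhas ctx0 w M a, tight a, dnorm a = val_prob m k
      & expected_steps m k <= w].
Proof.
move=> cM [m0 r].
have [] := mdist_completeness k m r; rewrite m0 /closed_mdist /= ?cM //.
move=> w [a [/mhas1E h1 h2 h3 h4]]; exists w, a; split=> //.
by move: h4; rewrite /mass big_seq1.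
Qed.
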